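(* (i) For every integer $n>3$, $$\inf_{x\ge 0}\ \sup_{\mathcal{P}_n}\left|\frac{\mathbf{P}(t_n^*\ge x)}{\Phi_c(x)}-1\right|\ \ge\ 1.25\,\exp\!\left(-\frac{1}{2(n-2)}\right)-1\ >\ 0.$$ (ii) If $\{x_n\}$ is a non-decreasing sequence of positive numbers such that $1\ll x_n\le\sqrt{n}$ as $n\to\infty$ (that is, $x_n\to\infty$ and $x_n\le\sqrt n$), then $$\sup_{\mathcal{P}_n}\left|\frac{\mathbf{P}(t_n^*\ge x_n)}{\Phi_c(x_n)}-1\right|\to\infty\qquad(n\to\infty).$$
   Context: $\Phi$ is the standard normal distribution function and $\Phi_c=1-\Phi$. $\mathcal{P}_n$ is the class of distributions of random vectors $(X_1,\dots,X_n)$ such that $X,X_1,\dots,X_n$ are independent and identically distributed bounded real random variables with $\mathbf{E}X=0$ and $\mathbf{E}X^2=1$. The supremum $\sup_{\mathcal{P}_n}$ is over all such distributions. The self-normalised sum is $$t_n^*=\frac{S_n}{T_n^{1/2}},\qquad S_n=\sum_{i=1}^nX_i,\qquad T_n=\sum_{i=1}^nX_i^2.$$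
   Formalization: In (i), the final inequality 1.25 exp(-1/(2(n-2))) - 1 > 0 is false at n = 4 (value about -0.027); it is asserted only for n > 4, while the lower bound on the infimum and positivity of the infimum are proved for every n > 3. *)

(* Defs.v *)
From HB Require Import structures.
From mathcomp Require Export all_boot all_order all_algebra.
From mathcomp Require Export all_classical all_reals all_analysis.
Export Order.TTheory GRing.Theory Num.Theory numFieldNormedType.Exports.

Set Implicit Arguments.
Unset Strict Implicit.
Unset Printing Implicit Defensive.

Local Open Scope classical_set_scope.
Local Open Scope ring_scope.

Definition Phi (R : realType) (x : R) : R :=
  fine (normal_prob (0 : R) 1 [set y : R | y <= x]).

Definition Phic (R : realType) (x : R) : R := 1 - Phi x.

Section families.
Context (d : measure_display) (T : measurableType d) (R : realType).
Context (P : probability T R).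

Definition mutually_independent (I : finType) (X : I -> {RV P >-> R}) : Prop :=
  forall (J : {set I}) (B : I -> set R), (forall i, measurable (B i)) ->
    P (\bigcap_(i in [set` J]) (X i @^-1` B i)) =
    (\prod_(i in J) P (X i @^-1` B i))%E.

Definition identically_distributed (I : finType) (X : I -> {RV P >-> R})
    : Prop :=
  forall (i j : I) (B : set R), measurable B ->
    distribution P (X i) B = distribution P (X j) B.

(* The generic copy [X] is indexed by [None] and [X_i] by [Some i]. *)
Definition with_copy (n : nat) (X : {RV P >-> R}) (Xs : 'I_n -> {RV P >-> R})
    : option 'I_n -> {RV P >-> R} :=
  fun o => if o is Some i then Xs i else X.

Definition in_class (n : nat) (Xs : 'I_n -> {RV P >-> R}) : Prop :=
  exists X : {RV P >-> R},
    [/\ mutually_independent (with_copy X Xs),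
        identically_distributed (with_copy X Xs),
        forall o, bounded_fun (with_copy X Xs o : T -> R),
        ('E_P[X] = 0)%E
      & ('E_P[(fun w => X w ^+ 2)%R] = 1)%E].

Definition selfnorm_sum (n : nat) (Xs : 'I_n -> {RV P >-> R}) (w : T) : R :=
  \sum_(i < n) Xs i w.

Definition selfnorm_sqsum (n : nat) (Xs : 'I_n -> {RV P >-> R}) (w : T) : R :=
  \sum_(i < n) Xs i w ^+ 2.

(* On the event that all the [X_i] vanish, [0 / 0 = 0] gives the value 0. *)
Definition tstar (n : nat) (Xs : 'I_n -> {RV P >-> R}) (w : T) : R :=
  selfnorm_sum Xs w / Num.sqrt (selfnorm_sqsum Xs w).

Definition rel_dev (n : nat) (Xs : 'I_n -> {RV P >-> R}) (x : R) : R :=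
  `| fine (P [set w | x <= tstar Xs w]) / Phic x - 1 |.

End families.

(* [rel_dev] depends on [Xs] only through its joint distribution, so the
   supremum over distributions is taken over all random vectors in the class,
   on arbitrary probability spaces. *)
Definition sup_rel_dev (R : realType) (n : nat) (x : R) : \bar R :=
  ereal_sup [set y : \bar R |
    exists (d : measure_display) (T : measurableType d) (P : probability T R)
           (Xs : 'I_n -> {RV P >-> R}),
      in_class Xs /\ y = (rel_dev Xs x)%:E].

(* Main.v *)
Require Import Defs.
From HB Require Import structures.
From mathcomp Require Import measurable_realfun lra ring.

Set Implicit Arguments.
Unset Strict Implicit.
Unset Printing Implicit Defensive.

Local Open Scope classical_set_scope.
Local Open Scope ring_scope.

(** The class of admissible samples contains arbitrarily skewed two-point laws.
    Let [X] equal [a] with probability [q] and [- 1 / a] with probability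
    [1 - q]; if [a ^+ 2 = (1 - q) / q], then [E X = 0] and [E X^2 = 1].
    As [q] tends to [1] the event that all [n] observations equal [a] has
    probability [q ^+ n], which tends to [1], and on that event
    [S_n / sqrt T_n] is [sqrt n], the largest value that the Cauchy-Schwarz
    inequality permits.  Although [a] itself tends to [0], self-normalisation
    makes its size irrelevant.  Hence for every [x <= sqrt n] the supremum of
    [P (t_n^* >= x)] is [1], and the worst relative deviation is at least
    [1 / Phic x - 1] ([sup_rel_dev_ge_Phic]).

    For (i): when [0 <= x <= sqrt n] this bound is at least [1], because
    [Phic x <= 1 / 2]; when [x > sqrt n] the event [t_n^* >= x] is empty and
    the relative deviation is exactly [1].  So the infimum is at least [1]
    ([sup_rel_dev_ge1]), which exceeds [5 / 4 * exp (- _) - 1 <= 1 / 4].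
    For (ii): [Phic (x_n)] is positive and tends to [0], so
    [1 / Phic (x_n) - 1] tends to infinity. *)

(** * Finitely many independent tosses of a biased coin *)

(** A copy of the finite function space, so that the discrete sigma-algebra
    becomes its canonical one. *)
Definition tosses (I : finType) : Type := {ffun I -> bool}.

HB.instance Definition _ (I : finType) := Finite.copy (tosses I) {ffun I -> bool}.
HB.instance Definition _ (I : finType) :=
  isPointed.Build (tosses I) [ffun => true].
HB.instance Definition _ (I : finType) :=
  @isMeasurable.Build default_measure_display (tosses I) discrete_measurable
    discrete_measurable0 discrete_measurableC discrete_measurableU.

Section biased_tosses.
Context (R : realType) (I : finType) (q : {i01 R}).
Implicit Types (f : tosses I) (A : set (tosses I)).

Definition coin (b : bool) : R := if b then q%:num else 1 - q%:num.

Lemma coin_ge0 b : 0 <= coin b.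
Proof. by case: b; rewrite /coin// subr_ge0. Qed.

Definition tosses_pmf f : R := \prod_i coin (f i).

Lemma tosses_pmf_ge0 f : 0 <= tosses_pmf f.
Proof. by apply: prodr_ge0 => i _; exact: coin_ge0. Qed.

(** The atoms are numbered because finite sums of measures are indexed by
    natural numbers; the default [point] of [nth] is never reached. *)
Definition tosses_prob : set (tosses I) -> \bar R :=
  msum (fun k => let f := nth point (enum {: tosses I}) k in
                 mscale (NngNum (tosses_pmf_ge0 f)) \d_f) #|{: tosses I}|.

HB.instance Definition _ := Measure.on tosses_prob.

Lemma tosses_probE A :
  tosses_prob A = (\sum_f tosses_pmf f * (f \in A)%:R)%:E.
Proof.
rewrite /tosses_prob /msum -sumEFin -[RHS]big_enum/= (big_nth point) big_mkord cardE.
by apply: eq_bigr => k _; rewrite /mscale/= diracE -EFinM.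
Qed.

(** The weight of an outcome and the indicator of a cylinder are both products
    over the coordinates, so distributing a product over sums of two terms
    gives the sum over all outcomes.  Independence, the common law and the
    probability of a constant run are all read off from this formula. *)
Lemma tosses_prob_cylinder (J : {set I}) (B : I -> set bool) :
  tosses_prob (\bigcap_(i in [set` J]) [set f | B i (f i)]) =
  (\prod_(i in J) \sum_b coin b * (b \in B i)%:R)%:E.
Proof.
rewrite tosses_probE; congr EFin.
(* Coordinates outside [J] are unconstrained and contribute total mass 1. *)
pose F i b := coin b * (if i \in J then (b \in B i)%:R else 1).
transitivity (\prod_i \sum_b F i b); last first.
  rewrite [RHS]big_mkcond/=; apply: eq_bigr => i _; rewrite /F.
  case: ifP => // _; rewrite big_bool/= /coin; ring.
rewrite bigA_distr_bigA; apply: eq_bigr => f _; rewrite big_split/=.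
congr (_ * _); rewrite -big_mkcond/=.
have [fA|fA] := boolP (f \in _).
  rewrite big1// => i iJ; rewrite (_ : _ \in _)//.
  by move: fA; rewrite !inE => /(_ i iJ).
have [i iJ fi] : exists2 i, i \in J & ~ B i (f i).
  move: fA; rewrite notin_setE/= => /existsNP[i /not_implyP[iJ Bi]].
  by exists i.
by rewrite (bigD1 i)//= (_ : (_ \in _) = false) ?mul0r//; exact/memNset.
Qed.

Lemma tosses_prob_setT : tosses_prob setT = 1%E.
Proof.
rewrite -(bigcap_set0 (fun i : I => [set f : tosses I | setT (f i)])).
have -> : set0 = [set` (finset.set0 : {set I})].
  by apply/seteqP; split=> // x /=; rewrite inE.
by rewrite (tosses_prob_cylinder finset.set0 (fun=> setT)) big_set0.
Qed.

HB.instance Definition _ :=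
  Measure_isProbability.Build _ _ _ tosses_prob tosses_prob_setT.

Lemma tosses_prob_coord (i : I) (B : set bool) :
  tosses_prob [set f | B (f i)] = (\sum_b coin b * (b \in B)%:R)%:E.
Proof.
have := tosses_prob_cylinder [set i]%SET (fun=> B).
rewrite big_set1 => <-; congr tosses_prob.
apply/seteqP; split=> f /=; first by move=> fB j /=; rewrite inE => /eqP ->.
by apply; rewrite /= inE.
Qed.

Definition coord (v : bool -> R) (i : I) : tosses I -> R := fun f => v (f i).

Lemma coord_measurable v i : measurable_fun setT (coord v i).
Proof. by []. Qed.

HB.instance Definition _ v i :=
  isMeasurableFun.Build _ _ _ _ (coord v i) (coord_measurable v i).

Lemma expectation_coord v i :
  ('E_tosses_prob[coord v i] =
  (q%:num * v true + (1 - q%:num) * v false)%:E)%E.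
Proof.
pose A := [set f : tosses I | f i].
have -> : (coord v i : tosses I -> R) =
    cst (v false) \+ ((v true - v false) \o* \1_A).
  apply/funext => f; rewrite /coord /= indicE.
  have -> : (f \in A) = f i by apply/idP/idP; rewrite inE.
  by case: (f i); rewrite /= ?mulr1n ?mulr0n; ring.
have A1 : (\1_A : tosses I -> R) \in Lfun tosses_prob 1.
  apply/Lfun1_integrable; exact/integrable_indic.
rewrite expectationD ?Lfun_cst ?Lfun_scale// expectation_cst expectationZl//.
have PA : (tosses_prob : probability _ R) A = q%:num%:E.
  rewrite [LHS](tosses_prob_coord i [set b | b]) big_bool mem_set// memNset//=.
  by rewrite mulr1 mulr0 addr0.
by rewrite expectation_indic// PA -EFinM -EFinD; congr EFin; ring.
Qed.

Lemma coord_independent v :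
  mutually_independent (fun i => coord v i : {RV tosses_prob >-> R}).
Proof.
move=> J B _.
rewrite [LHS](tosses_prob_cylinder J (fun i => v @^-1` B i)) -prodEFin.
by apply: eq_bigr => i _; exact/esym/(tosses_prob_coord i (v @^-1` B i)).
Qed.

Lemma coord_identically_distributed v :
  identically_distributed (fun i => coord v i : {RV tosses_prob >-> R}).
Proof.
move=> i j B _; rewrite /distribution /pushforward.
rewrite [LHS](tosses_prob_coord i (v @^-1` B)).
exact/esym/(tosses_prob_coord j (v @^-1` B)).
Qed.

Lemma coord_bounded v i : bounded_fun (coord v i : tosses I -> R).
Proof.
exists (`|v true| + `|v false|); split; first exact: num_real.
move=> M vM f _ /=; apply: le_trans (ltW vM); rewrite /coord.
by case: (f i); rewrite ?lerDl ?lerDr.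
Qed.

End biased_tosses.

Arguments tosses_prob {R} I q.
(** * The upper tail of the standard normal law *)

Section normal_tail.
Context (R : realType).
Implicit Types x : R.

Let N : probability (measurableTypeR R) R := normal_prob (0 : R) 1.

Lemma PhicE x : Phic x = fine (N `]x, +oo[%classic).
Proof.
have -> : `]x, +oo[%classic = ~` [set y | y <= x].
  by apply/seteqP; split=> y /=; rewrite in_itv/= andbT ltNge => /negP.
rewrite probability_setC; last by rewrite -set_itvNyc.
by rewrite fineB// ?fin_num_measure// -set_itvNyc.
Qed.

(** The density is even, so each half-line carries half of the mass. *)
Lemma Phic_le12 x : 0 <= x -> Phic x <= 1 / 2.
Proof.
move=> x0; rewrite PhicE -lee_fin fineK ?fin_num_measure//.
apply: (@le_trans _ _ (N [set y | 0 <= y])).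
  apply: le_measure; rewrite ?inE//; first by rewrite -set_itvcy.
  by move=> y /=; rewrite in_itv/= andbT => /ltW; exact: le_trans.
have : (N setT = 2%:E * N [set y | (0 <= y)%R])%E.
  apply: ge0_symfun_integralT.
  - by move=> y; exact: normal_pdf_ge0.
  - exact/continuous_normal_pdf/oner_neq0.
  - by move=> y /=; rewrite normal_pdfE ?oner_neq0// /normal_fun !subr0 sqrrN.
rewrite probability_setT.
have : N [set y | 0 <= y] \is a fin_num.
  by rewrite fin_num_measure// -set_itvcy.
move: (N _) => [r| |]// _; rewrite -EFinM => -[r2].
by rewrite lee_fin; lra.
Qed.

(** The density is bounded below by a positive constant on the interval
    [`]x, x + 1]], where [`|y| <= `|x| + 1]. *)
Lemma Phic_gt0 x : 0 < Phic x.
Proof.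
rewrite PhicE -lte_fin fineK ?fin_num_measure//.
pose c := normal_peak (1 : R) * expR (- (`|x| + 1) ^+ 2 / (1 ^+ 2 *+ 2)).
have c0 : 0 < c by rewrite mulr_gt0 ?expR_gt0 ?normal_peak_gt0 ?oner_neq0.
apply: (@lt_le_trans _ _ (N `]x, x + 1]%classic)); last first.
  apply: le_measure; rewrite ?inE//.
  by move=> y /=; rewrite !in_itv/= andbT => /andP[].
apply: (@lt_le_trans _ _ (\int[lebesgue_measure]_(y in `]x, (x + 1)%R]%classic) c%:E)%E).
  rewrite integral_cst//= lebesgue_measure_itv/= lte_fin ltrDl ltr01.
  by rewrite -EFinB addrAC subrr add0r mule1 lte_fin.
apply: ge0_le_integral => //.
- by move=> y _; rewrite lee_fin ltW.
- apply/measurable_EFinP; apply: measurable_funTS.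
  exact: measurable_normal_pdf.
move=> y /=; rewrite in_itv/= => /andP[xy yx].
rewrite lee_fin normal_pdfE ?oner_neq0// ler_pM2l ?normal_peak_gt0 ?oner_neq0//.
rewrite /normal_fun ler_expR !mulNr lerN2 subr0 ler_pM2r; last first.
  by rewrite invr_gt0 expr1n; lra.
rewrite -[leLHS]real_normK ?num_real// ler_sqr ?nnegrE ?addr_ge0//.
rewrite ler_norml; apply/andP; split.
  have := ler_norm (- x); rewrite normrN; lra.
have := ler_norm x; lra.
Qed.

(* A random variable whose distribution function is [Phi]. *)
Let idR : measurableTypeR R -> R := idfun.

#[local] HB.instance Definition _ :=
  @isMeasurableFun.Build _ _ _ _ idR (@measurable_id _ _ setT).

Lemma Phic_cvg0 : Phic x @[x --> +oo] --> (0 : R).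
Proof.
have := cvg_cdfy1 (idR : {RV N >-> R}).
move=> /fine_cvgP[_ cdf1].
rewrite -(subrr 1); apply: cvgB; first exact: cvg_cst.
apply: cvg_trans cdf1; apply: near_eq_cvg.
apply: nearW => x /=; rewrite /Phi /cdf /distribution /pushforward.
by congr (fine (N _)); apply/seteqP; split => y /=; rewrite in_itv.
Qed.

End normal_tail.

(** * The skewed two-point sample *)

(** Cauchy-Schwarz, in the form [0 <= \sum_i (n X_i - S) ^+ 2]. *)
Lemma tstar_le_sqrtn d (T : measurableType d) (R : realType)
    (P : probability T R) n (Xs : 'I_n -> {RV P >-> R}) w :
  tstar Xs w <= Num.sqrt n%:R.
Proof.
rewrite /tstar; set S := selfnorm_sum Xs w; set Q := selfnorm_sqsum Xs w.
have Q0 : 0 <= Q by apply: sumr_ge0 => i _; exact: sqr_ge0.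
have [Qp|] := ltP 0 Q; last first.
  by move=> Qn; rewrite (ler0_sqrtr Qn) invr0 mulr0 sqrtr_ge0.
rewrite ler_pdivrMr ?sqrtr_gt0// -sqrtrM// (le_trans (ler_norm S))//.
rewrite -sqrtr_sqr ler_sqrt ?mulr_ge0//.
have [n0|n0] := posnP n.
  rewrite /S /selfnorm_sum big1 ?expr0n ?mulr_ge0// => i _.
  by have := ltn_ord i; rewrite {2}n0.
have : 0 <= \sum_(i < n) (n%:R * Xs i w - S) ^+ 2.
  by apply: sumr_ge0 => i _; exact: sqr_ge0.
have -> : \sum_(i < n) (n%:R * Xs i w - S) ^+ 2 = n%:R * (n%:R * Q - S ^+ 2).
  transitivity (\sum_(i < n) (n%:R ^+ 2 * Xs i w ^+ 2 + (- 2 * n%:R * S) * Xs i w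
                              + S ^+ 2)).
    by apply: eq_bigr => i _; ring.
  rewrite !big_split/= -!mulr_sumr sumr_const card_ord -mulr_natl.
  by rewrite -/(selfnorm_sum Xs w) -/(selfnorm_sqsum Xs w) -/S -/Q; ring.
by rewrite pmulr_rge0 ?ltr0n// subr_ge0.
Qed.

Lemma bernoulli_ineq (R : realDomainType) (e : R) n :
  0 <= e <= 1 -> 1 - n%:R * e <= (1 - e) ^+ n.
Proof.
move=> /andP[e0 e1]; elim: n => [|n IHn]; first by rewrite mul0r subr0 expr0.
rewrite exprSr; apply: le_trans (ler_wpM2r _ IHn); last by rewrite subr_ge0.
have : 0 <= n%:R * e * e by rewrite !mulr_ge0.
by rewrite -natr1; nra.
Qed.

Section skewed_sample.
Context (R : realType) (n : nat) (q : {i01 R}).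
Hypothesis q01 : 0 < q%:num < 1.

(** The value that makes the two moment conditions hold; see
    [skewed_sample_in_class]. *)
Let a : R := Num.sqrt ((1 - q%:num) / q%:num).

Let a_gt0 : 0 < a.
Proof. by case/andP: q01 => ? ?; rewrite sqrtr_gt0 divr_gt0// subr_gt0. Qed.

Let sqr_a : a ^+ 2 = (1 - q%:num) / q%:num.
Proof.
by case/andP: q01 => ? ?; rewrite sqr_sqrtr// divr_ge0// subr_ge0 ltW.
Qed.

Definition skewed_value (b : bool) : R := if b then a else - a^-1.

(** Coordinate [None] is reserved for the generic copy [X]. *)
Definition skewed_sample (i : 'I_n) :
    {RV (tosses_prob (option 'I_n) q) >-> R} :=
  coord skewed_value (Some i).

Lemma skewed_sample_in_class : in_class skewed_sample.
Proof.
have [q0 q1] := andP q01.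
exists (coord skewed_value None).
have -> : with_copy (coord skewed_value None) skewed_sample =
    (fun o => coord skewed_value o : {RV (tosses_prob (option 'I_n) q) >-> R}).
  by apply/funext => -[].
split.
- exact: coord_independent.
- exact: coord_identically_distributed.
- by move=> o; exact: coord_bounded.
- rewrite [LHS](expectation_coord q skewed_value None); congr EFin.
  have -> : 1 - q%:num = q%:num * a ^+ 2 by rewrite sqr_a mulrC divfK ?gt_eqF.
  by rewrite /skewed_value; field; rewrite gt_eqF.
- rewrite [LHS](expectation_coord q (fun b => skewed_value b ^+ 2) None).
  congr EFin; rewrite /skewed_value sqrrN exprVn sqr_a.
  by field; rewrite subr_eq0 !gt_eqF.
Qed.

Hypothesis n_gt0 : (0 < n)%N.

Lemma tstar_skewed_sample (f : tosses (option 'I_n)) :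
  (forall i, f (Some i)) -> tstar skewed_sample f = Num.sqrt n%:R.
Proof.
move=> ft; rewrite /tstar /selfnorm_sum /selfnorm_sqsum.
have E i : skewed_sample i f = a by rewrite /skewed_sample/= /coord ft.
under eq_bigr do rewrite E.
under [X in Num.sqrt X]eq_bigr do rewrite E.
rewrite !sumr_const card_ord -(mulr_natl a) -(mulr_natl (a ^+ 2)) sqrtrM ?ler0n//.
rewrite sqrtr_sqr gtr0_norm//; set s := Num.sqrt n%:R.
have s0 : s != 0 by rewrite sqrtr_eq0 -ltNge ltr0n.
have -> : n%:R = s ^+ 2 by rewrite sqr_sqrtr ?ler0n.
by field; rewrite s0 gt_eqF.
Qed.

(** It suffices that all [n] tosses succeed. *)
Lemma skewed_sample_prob_ge x : x <= Num.sqrt n%:R ->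
  q%:num ^+ n <=
  fine (tosses_prob (option 'I_n) q [set f | x <= tstar skewed_sample f]).
Proof.
move=> xn; rewrite -lee_fin fineK ?fin_num_measure//.
pose J := [set Some i | i in [set: 'I_n]%SET]%SET.
have := tosses_prob_cylinder q J (fun=> [set true]).
rewrite (eq_bigr (fun=> q%:num)); last first.
  move=> i _; rewrite big_bool/= mem_set// memNset//=.
  by rewrite mulr1 mulr0 addr0.
rewrite prodr_const card_imset; last exact: Some_inj.
rewrite cardsT card_ord => <-; apply: le_measure; rewrite ?inE//.
move=> f /= fJ; rewrite tstar_skewed_sample// => i.
have /= -> // := fJ (Some i); exact: imset_f.
Qed.

End skewed_sample.

(** * Lower bounds on the worst relative deviation *)

Section sup_rel_dev_bounds.
Context (R : realType) (n : nat) (x : R).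
Hypothesis n_gt0 : (0 < n)%N.

Lemma sup_rel_dev_ge_Phic : x <= Num.sqrt n%:R ->
  (((Phic x)^-1 - 1)%:E <= sup_rel_dev n x)%E.
Proof.
move=> xn; apply/lee_addgt0Pr => e e0.
(* [d = 1 - q] must keep the coin nondegenerate and make the loss [n * d] in
   Bernoulli's inequality at most [e] relative to [Phic x]. *)
pose d := Num.min (1 / 2) (e * Phic x / n%:R).
have d0 : 0 < d by rewrite lt_min !divr_gt0// ?mulr_gt0 ?Phic_gt0 ?ltr0n.
have d1 : d <= 1 / 2 by rewrite ge_min lexx.
have dn : n%:R * d <= e * Phic x.
  by rewrite mulrC -ler_pdivlMr ?ltr0n// ge_min lexx orbT.
have q0 : 0 <= 1 - d by lra.
have q1 : 1 - d <= 1 by lra.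
pose q := Itv01 q0 q1.
have q01 : 0 < q%:num < 1 by apply/andP; split => /=; lra.
apply: (@le_trans _ _ ((rel_dev (@skewed_sample R n q) x)%:E + e%:E)%E).
  rewrite -EFinD lee_fin /rel_dev -lerBlDr (le_trans _ (ler_norm _))//.
  rewrite addrAC lerD2r ler_pdivlMr ?Phic_gt0//.
  apply: le_trans (skewed_sample_prob_ge q01 n_gt0 xn).
  apply: (@le_trans _ _ (1 - n%:R * d)); last by apply: bernoulli_ineq; lra.
  by rewrite mulrBl mulVf ?gt_eqF ?Phic_gt0// lerD2l lerN2.
rewrite leeD2r//; apply: ereal_sup_ubound.
do 4!eexists; split; last reflexivity; exact: skewed_sample_in_class.
Qed.

(** Here [t_n^* >= x] is impossible, so every member of the class has relative
    deviation [`|0 - 1|]; a fair coin shows that the class is inhabited. *)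
Lemma sup_rel_dev_ge1_beyond : Num.sqrt n%:R < x ->
  (1%:E <= sup_rel_dev n x)%E.
Proof.
move=> xn; apply: ereal_sup_ubound.
have q0 : (0 : R) <= 1 / 2 by lra.
have q1 : (1 / 2 : R) <= 1 by lra.
pose q := Itv01 q0 q1.
have q01 : 0 < q%:num < 1 by apply/andP; split => /=; lra.
do 3!eexists; exists (@skewed_sample R n q).
split; first exact: skewed_sample_in_class.
rewrite /rel_dev (_ : [set _ | _] = set0) ?measure0 ?mul0r ?sub0r ?normrN1//.
apply/seteqP; split => // w /= xt.
by have := le_lt_trans (le_trans xt (tstar_le_sqrtn _ _)) xn; rewrite ltxx.
Qed.

Lemma sup_rel_dev_ge1 : 0 <= x -> (1%:E <= sup_rel_dev n x)%E.
Proof.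
move=> x0; have [/sup_rel_dev_ge_Phic|] := leP x (Num.sqrt n%:R); last first.
  exact: sup_rel_dev_ge1_beyond.
apply: le_trans; rewrite lee_fin lerBrDr.
rewrite -[leLHS]invrK lef_pV2 ?posrE ?invr_gt0 ?Phic_gt0//.
by apply: le_trans (Phic_le12 x0) _; rewrite div1r.
Qed.

End sup_rel_dev_bounds.

Theorem theorem1 (R : realType) :
  (forall n : nat, (3 < n)%N ->
     [/\ ((5 / 4 * expR (- (1 / (2 * (n%:R - 2)))) - 1)%:E
            <= ereal_inf [set sup_rel_dev n x | x in [set x : R | (0 <= x)%R]])%E,
         (0 < ereal_inf [set sup_rel_dev n x | x in [set x : R | (0 <= x)%R]])%E
       & (4 < n)%N -> 0 < 5 / 4 * expR (- (1 / (2 * (n%:R - 2)))) - 1 :> R])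
  /\
  (forall x : nat -> R,
     (forall n : nat, (0 < n)%N -> 0 < x n) ->
     (forall m n : nat, (0 < m)%N -> (m <= n)%N -> x m <= x n) ->
     x n @[n --> \oo] --> +oo ->
     (forall n : nat, (0 < n)%N -> x n <= Num.sqrt n%:R) ->
     sup_rel_dev n (x n) @[n --> \oo] --> +oo%E).
Proof.
split=> [n n3 | x _ _ x_cvg x_le].
  have n0 : (0 < n)%N by exact: ltn_trans n3.
  have n4 : (4 : R) <= n%:R by rewrite ler_nat.
  have inf1 : (1%:E <=
      ereal_inf [set sup_rel_dev n x | x in [set x : R | (0 <= x)%R]])%E.
    by apply/ereal_infP => _ [x x0 <-]; exact: sup_rel_dev_ge1.
  split.
  - apply: le_trans inf1; rewrite lee_fin.
    have : expR (- (1 / (2 * (n%:R - 2)))) <= 1 :> R.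
      by rewrite -[leRHS]expR0 ler_expR oppr_le0 divr_ge0//; lra.
    lra.
  - by apply: lt_le_trans inf1; rewrite lte_fin.
  (* [exp (- 1 / 6) >= 5 / 6 > 4 / 5]. *)
  - move=> n5; have {}n5 : (5 : R) <= n%:R by rewrite ler_nat.
    have := expR_ge1Dx (- (1 / (2 * (n%:R - 2))) : R).
    have : 1 / (2 * (n%:R - 2)) <= 1 / 6 :> R.
      by rewrite ler_pdivrMr; lra.
    lra.
apply/cvgeyPge => A.
have Phic_x : Phic (x n) @[n --> \oo] --> (0 : R).
  exact: (cvg_comp _ _ x_cvg (@Phic_cvg0 R)).
have A1 : 0 < (`|A| + 1)^-1 by rewrite invr_gt0 ltr_wpDl.
near=> n.
have n0 : (0 < n)%N by near: n; exists 1%N.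
apply: le_trans (sup_rel_dev_ge_Phic n0 (x_le n n0)); rewrite lee_fin.
rewrite lerBrDr (le_trans (_ : _ <= `|A| + 1)) ?lerD2r ?ler_norm//.
rewrite -[leLHS]invrK lef_pV2 ?posrE ?Phic_gt0// ltW//.
rewrite -[ltLHS]ger0_norm ?(ltW (Phic_gt0 _))// -normrN -[- _]sub0r.
by near: n; apply: cvgr_dist_lt.
Unshelve. all: by end_near.
Qed.
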